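(* Let $C\ge 2$ be an integer and let $T$ be a set of positive integers that contains at most $C$ elements in every interval $(2^j,2^{j+1}]$, $j\in\mathbb{Z}$. Then there exists a real $\theta$ that is $\frac{1}{64C\log_2 C}$-regular for all $t\in T$. Moreover, if $T$ is computable, then such a $\theta$ can be chosen to be a computable real.
   Context: For a real $x$, $d(x,\mathbb{Z})$ denotes the distance from $x$ to the nearest integer. For $\varepsilon>0$ and a positive integer $t$, a real $\theta$ is $\varepsilon$-regular for the denominator $t$ if $d(t\theta,\mathbb{Z})>\varepsilon$. *)

(* Defs.v *)
From HB Require Import structures.
From mathcomp Require Import all_boot all_order all_algebra.
From mathcomp Require Import all_classical all_reals all_analysis.

Set Implicit Arguments.
Unset Strict Implicit.
Unset Printing Implicit Defensive.

Import Order.TTheory GRing.Theory Num.Theory.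

Local Open Scope classical_set_scope.
Local Open Scope ring_scope.

(* Total recursive functions: the least class containing zero, successor and
   projections, closed under composition, primitive recursion and minimization
   of regular functions (those whose least zero exists for every argument).
   Primitive recursion and minimization are given by the equations that
   determine the function [g] being defined. *)
Inductive recursive : forall n : nat, (n.-tuple nat -> nat) -> Prop :=
| recursive_zero n : recursive (fun _ : n.-tuple nat => 0%N)
| recursive_succ : recursive (fun v : 1.-tuple nat => (tnth v ord0).+1)
| recursive_proj n (i : 'I_n) : recursive (fun v : n.-tuple nat => tnth v i)
| recursive_comp m n (f : m.-tuple nat -> nat) (h : 'I_m -> n.-tuple nat -> nat) :
    recursive f -> (forall i, recursive (h i)) ->
    recursive (fun v : n.-tuple nat => f [tuple h i v | i < m])
| recursive_prec n (f : n.-tuple nat -> nat) (h : n.+2.-tuple nat -> nat)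
    (g : n.+1.-tuple nat -> nat) :
    recursive f -> recursive h ->
    (forall v : n.-tuple nat, g [tuple of 0%N :: v] = f v) ->
    (forall k (v : n.-tuple nat),
      g [tuple of k.+1 :: v] = h [tuple of k :: g [tuple of k :: v] :: v]) ->
    recursive g
| recursive_min n (f : n.+1.-tuple nat -> nat) (g : n.-tuple nat -> nat) :
    recursive f ->
    (forall v : n.-tuple nat, f [tuple of g v :: v] = 0%N) ->
    (forall (v : n.-tuple nat) k, (k < g v)%N -> f [tuple of k :: v] <> 0%N) ->
    recursive g.

Definition computable_fun (f : nat -> nat) : Prop :=
  recursive (fun v : 1.-tuple nat => f (tnth v ord0)).

Definition computable_set (T : set nat) : Prop :=
  computable_fun (fun t => nat_of_bool `[< T t >]).

(* [x] is the limit of the computable sequence of rationals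
   (-1) ^ s(k) * a(k) / b(k), with error at most 2 ^ (-k) at step [k]. *)
Definition computable_real (R : realType) (x : R) : Prop :=
  exists s a b : nat -> nat,
    [/\ computable_fun s, computable_fun a, computable_fun b,
        forall k, b k <> 0%N &
        forall k, `|x - (-1) ^+ s k * (a k)%:R / (b k)%:R| <= 2 ^- k].

Definition dist_int (R : realType) (x : R) : R :=
  inf (range (fun n : int => `|x - n%:~R|)).

Definition eps_regular (R : realType) (eps : R) (t : nat) (theta : R) : Prop :=
  eps < dist_int (t%:R * theta).

Definition log2 (R : realType) (x : R) : R := ln x / ln 2.

Definition dyadic_interval (R : realType) (j : int) : set nat :=
  [set t | (2 : R) ^ j < t%:R <= (2 : R) ^ (j + 1)].

(* Main.v *)
(**
Partition T into octaves (2^(i-1), 2^i] and remove from the line, octave after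
octave, the points at distance at most 1/(E t) from (1/t)Z, where 1/E is slightly
larger than the required eps. Write A_K for what is left after K octaves. A bad
set of octave K + h meets a union A of intervals in measure at most
(2/E) (mu(A) + N(A)/t), N(A) being the number of components of A. So, apart from
the next h octaves, the loss is proportional to the measure left plus a
multiple of 2^-K times the number of components, and the latter grows by at most
one for each right end of a bad interval lying in A_K. Hence, with
rho = h/(h+1) and kappa = 1/(2E), the potential
    mu(A_K) - 2 kappa 2^-K N(A_K)
      - sum_(j < h) rho^-(j+1) * (measure and component cost of octave K + j)
loses at most a factor rho < 1 at each step, up to an error O(2^-K).

Counting components by these right ends makes the whole potential additive over
subintervals; a subinterval may have one more component than right ends, which is
where the error comes from. As 2 rho > 1, the potential decays more slowly than
2^-K, so after every second octave the current interval can be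
halved and one half keeps a potential at least 2^-K. The nested intervals converge
to theta. The bad sets being unions of cells of a rational grid, the potential is
a rational number computed from T, which makes theta computable with T.
*)

Require Import Defs.
From HB Require Import structures.
From mathcomp Require Import all_boot all_order all_algebra.
From mathcomp Require Import zify ring lra.
From mathcomp Require Import all_classical all_reals all_analysis.

Set Implicit Arguments.
Unset Strict Implicit.
Unset Printing Implicit Defensive.

Import Order.TTheory GRing.Theory Num.Theory.

Local Open Scope classical_set_scope.
Local Open Scope card_scope.
Local Open Scope ring_scope.

(** * Counting a periodic set along the runs of another set *)

Lemma sum_period_shift (V : nmodType) (p y : nat) (F : nat -> V) :
    (forall z, F (z + p)%N = F z) ->
  \sum_(y <= z < y + p) F z = \sum_(0 <= z < p) F z.
Proof.
move=> F_per; elim: y => [|y <-]; first by rewrite add0n.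
case: p F_per => [|p] F_per; first by rewrite !addn0 !big_geq.
rewrite [RHS]big_ltn ?addSn ?big_nat_recr ?F_per 1?addrC //=; lia.
Qed.

Definition periodic_count (P : nat -> bool) (p c : nat) : Prop :=
  [/\ (0 < p)%N, forall z, P (z + p)%N = P z & (\sum_(0 <= z < p) P z <= c)%N].

Section PeriodicAlongRuns.
Local Open Scope nat_scope.
Variables (X : nat -> bool) (starts : nat -> nat) (a : nat).
Hypothesis starts_run :
  forall y, a <= y -> X y -> (y == a) || ~~ X y.-1 -> 0 < starts y.

(* Going back from [z], one meets [p] points of [X] or the start of a run. *)
Lemma run_window p z : 0 < p -> a <= z -> X z ->
  exists2 y, (a <= y <= z) && (z < y + p) &
    p <= \sum_(y <= x < z.+1) (X x + p * starts x).
Proof.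
elim: p z => // p IHp z _ az Xz.
have [z_start|] := boolP ((z == a) || ~~ X z.-1).
  exists z; first by lia.
  by rewrite big_nat1 (leq_trans _ (leq_addl _ _)) // leq_pmulr // starts_run.
rewrite negb_or negbK => /andP[za Xz1].
have [->|p_gt0] := posnP p.
  by exists z; rewrite ?big_nat1 ?Xz; lia.
have [|y ay p_le] := IHp z.-1 p_gt0 _ Xz1; first by lia.
exists y; first by lia.
rewrite prednK in p_le; last by lia.
rewrite big_nat_recr /=; last by lia.
suff : p <= \sum_(y <= x < z) (X x + p.+1 * starts x) by rewrite Xz; lia.
rewrite (leq_trans p_le) // leq_sum // => x _.
by rewrite leq_add2l leq_mul2r leqnSn orbT.
Qed.

Lemma periodic_run_count (P : nat -> bool) (p c b : nat) : periodic_count P p c ->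
  p * \sum_(a <= z < b) X z * P z <=
    c * \sum_(a <= z < b) (X z + p * starts z).
Proof.
case=> p_gt0 P_per P_le.
elim/ltn_ind: b => [[|b] IHb]; first by rewrite !big_geq ?muln0.
have [ab|ba] := leqP a b; last by rewrite !big_geq ?muln0.
have [Xb|nXb] := boolP (X b); last first.
  rewrite !big_nat_recr //= (negbTE nXb) addn0.
  by apply: leq_trans (IHb b (ltnSn b)) _; rewrite leq_mul2l leq_addr orbT.
have [y /andP[/andP[ay yb] byp] p_le] := run_window p_gt0 ab Xb.
have yb' : y <= b.+1 by lia.
rewrite (big_cat_nat (n := y)) // [in leqRHS](big_cat_nat (n := y)) //= !mulnDr.
rewrite leq_add ?IHb //.
rewrite mulnC leq_mul // (leq_trans _ P_le) //.
have P_per' z : (P (z + p) = P z :> nat) by rewrite P_per.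
rewrite -(sum_period_shift y P_per') (big_cat_nat (n := b.+1) (p := y + p)) //=.
rewrite (leq_trans _ (leq_addr _ _)) // leq_sum // => z _.
by case: (X z); rewrite ?mul1n.
Qed.

End PeriodicAlongRuns.

(** * The potential *)

(* [b i z] and [e i z] count the bad sets of octave [i] that contain the cell [z],
   respectively that end just before it, and [D] is the number of cells per unit
   of measure. The potential of a union of cells is the measure not covered by the
   first [K] octaves, minus what the components of that set and the next [h]
   octaves are expected to cost. *)
Section Potential.
Variables (R : realFieldType) (b e : nat -> nat -> nat) (D kappa rho : R) (h : nat).

Definition free (K z : nat) : bool := (\sum_(0 <= i < K) b i z == 0)%N.

Definition ends (K z : nat) : nat := (\sum_(0 <= i < K) e i z)%N.

Definition cost (i z : nat) : R := (b i z)%:R / D + kappa / 2 ^+ i * (e i z)%:R.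

Definition discounted (F : nat -> R) (K : nat) : R :=
  \sum_(0 <= j < h) rho ^- j.+1 * F (K + j)%N.

Definition density (K z : nat) : R :=
  D^-1 - 2 * kappa / 2 ^+ K * (ends K z)%:R - discounted (cost^~ z) K.

Definition potential (K l r : nat) : R :=
  \sum_(l <= z < r | free K z) density K z.

(* The measure of the free part of [l, r) when each of its components is lengthened
   by [x]; only the first one need not begin where a bad set ends. *)
Definition padded_measure (x : R) (K l r : nat) : R :=
  \sum_(l <= z < r | free K z) D^-1 +
  x * (\sum_(l <= z < r | free K z) (ends K z)%:R + 1).

Lemma padded_measure_le x y K l r :
  x <= y -> padded_measure x K l r <= padded_measure y K l r.
Proof. by move=> xy; rewrite lerD2l ler_wpM2r // addr_ge0 // sumr_ge0. Qed.

Lemma potential_cat K l m r : (l <= m <= r)%N ->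
  potential K l r = potential K l m + potential K m r.
Proof. by case/andP=> lm mr; rewrite /potential (big_cat_nat (n := m)). Qed.

Lemma potential_gt0 K l r : 0 < potential K l r ->
  exists2 z, (l <= z < r)%N & free K z.
Proof.
move=> pot_gt0; apply: contrapT => not_free; move: pot_gt0.
rewrite /potential big_nat_cond big_pred0 ?ltxx // => z.
by apply/negP => /andP[zlr fz]; apply: not_free; exists z.
Qed.

Lemma potential0 l r : (forall j z, (j < h)%N -> b j z = 0%N /\ e j z = 0%N) ->
  potential 0 l r = (r - l)%:R / D.
Proof.
move=> no_bad; rewrite mulr_natl -sumr_const_nat /potential big_mkcond.
apply: eq_bigr => z _; rewrite /free big_geq // /density /ends big_geq //.
rewrite mulr0 subr0 /discounted big_nat big1 ?subr0 // => j /= jh.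
rewrite /cost add0n; have [-> ->] := no_bad j z jh.
by rewrite mul0r mulr0 addr0 mulr0.
Qed.

Hypotheses (D_gt0 : 0 < D) (kappa_ge0 : 0 <= kappa) (rho_gt0 : 0 < rho).

Let expr2_neq0 n : 2 ^+ n != 0 :> R.
Proof. by rewrite expf_neq0. Qed.

Lemma padded_measure_ge0 x K l r : 0 <= x -> 0 <= padded_measure x K l r.
Proof.
move=> x_ge0; rewrite addr_ge0 ?mulr_ge0 ?addr_ge0 ?sumr_ge0 // => z _.
by rewrite invr_ge0 ltW.
Qed.

Lemma free_run_count (P : nat -> bool) (p c K l r : nat) : periodic_count P p c ->
    (forall z, free K z -> ~~ free K z.-1 -> (0 < ends K z)%N) ->
  (p * (\sum_(l <= z < r | free K z) P z) <=
   c * (\sum_(l <= z < r | free K z) 1 +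
        p * (\sum_(l <= z < r | free K z) ends K z).+1))%N.
Proof.
move=> P_per run_start; pose starts z := ((z == l) + free K z * ends K z)%N.
have starts_gt0 y : (l <= y)%N -> free K y -> (y == l) || ~~ free K y.-1 ->
    (0 < starts y)%N.
  move=> _ fy /orP[/eqP->|/(run_start _ fy)]; first by rewrite /starts eqxx.
  by rewrite /starts fy mul1n addn_gt0 => ->; rewrite orbT.
have free_sum F : (\sum_(l <= z < r | free K z) F z =
    \sum_(l <= z < r) free K z * F z)%N.
  by rewrite big_mkcond; apply: eq_bigr => z _; case: (free K z); rewrite ?mul1n.
rewrite !free_sum; apply: leq_trans (periodic_run_count starts_gt0 r P_per) _.
rewrite leq_mul2l big_split -big_distrr /=; apply/orP; right.
apply: leq_add; first by apply: leq_sum => z _; rewrite muln1.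
rewrite leq_mul2l /starts big_split /= -addn1 addnC leq_add2l; apply/orP; right.
have [rl|lr] := leqP r l; first by rewrite big_geq.
by rewrite big_ltn // eqxx big_nat big1 // => z /andP[lz _]; rewrite gtn_eqF.
Qed.

Lemma free_run_measure (P : nat -> bool) (p c K l r : nat) : periodic_count P p c ->
    (forall z, free K z -> ~~ free K z.-1 -> (0 < ends K z)%N) ->
  p%:R / D * \sum_(l <= z < r | free K z) (P z)%:R <=
    c%:R * padded_measure (p%:R / D) K l r.
Proof.
move=> P_per run_start; have := free_run_count l r P_per run_start.
have DVE : \sum_(l <= z < r | free K z) D^-1 =
    (\sum_(l <= z < r | free K z) 1)%N%:R / D.
  by rewrite natr_sum mulr_suml; apply: eq_bigr => z _; rewrite mul1r.
rewrite /padded_measure DVE -!natr_sum -(ler_nat R) !natrM natrD natrM.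
rewrite -[_.+1%:R]natr1; move: (_ + 1) => N1 count.
rewrite mulrAC ler_pdivrMr // (le_trans count) //.
by rewrite -[leRHS]mulrA mulrDl divfK ?gt_eqF // [_ / D * _]mulrAC divfK ?gt_eqF.
Qed.

Lemma cost_ge0 i z : 0 <= cost i z.
Proof. by rewrite addr_ge0 // ?mulr_ge0 ?invr_ge0 ?exprn_ge0 // ltW. Qed.

Lemma density_le K z : density K z <= D^-1.
Proof.
rewrite /density -addrA gerDl -opprD oppr_le0 addr_ge0 //.
  by rewrite !mulr_ge0 ?invr_ge0 ?exprn_ge0.
by apply: sumr_ge0 => j _; rewrite mulr_ge0 ?cost_ge0 // invr_ge0 exprn_ge0 // ltW.
Qed.

Lemma discountedS F K :
  discounted F K.+1 = rho * discounted F K - F K + rho ^- h * F (K + h)%N.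
Proof.
rewrite /discounted; elim: h => [|n IHn].
  by rewrite !big_geq // expr0 invr1 addn0; ring.
rewrite !big_nat_recr //= IHn addSn addnS exprSr invfM.
by field; rewrite expf_neq0 gt_eqF.
Qed.

Lemma densityS K z :
  density K.+1 z - (b K z)%:R / D =
    rho * density K z + (1 - rho) / D
    + kappa * (2 * rho - 1) / 2 ^+ K * (ends K z)%:R - rho ^- h * cost (K + h) z.
Proof.
rewrite /density discountedS [cost K z]/cost /ends big_nat_recr //= natrD exprSr.
by field; rewrite expr2_neq0 !gt_eqF ?exprn_gt0.
Qed.

Lemma le_potentialS K l r :
  \sum_(l <= z < r | free K z) (density K.+1 z - (b K z)%:R / D) <=
    potential K.+1 l r.
Proof.
rewrite /potential big_mkcond [leRHS]big_mkcond; apply: ler_sum => z _.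
rewrite /free big_nat_recr //= addn_eq0; case: (_ == 0)%N => //=.
case: posnP => [->|b_gt0]; first by rewrite mul0r subr0.
by rewrite subr_le0 (le_trans (density_le _ _)) // ler_peMl ?invr_ge0 ?ler1n // ltW.
Qed.

(* Since [q] bounds the cost per unit of the octave entering the window by
   [(1 - rho) * rho ^+ h], the term [(1 - rho) / D] of [densityS] pays for it; the
   components are paid by their own weight, which halves while [rho > 1 / 2]. *)
Lemma potentialS_ge (q : R) K l r :
  q <= (1 - rho) * rho ^+ h ->
  (1 - rho) * (2 / 2 ^+ h) <= kappa * (2 * rho - 1) ->
  \sum_(l <= z < r | free K z) cost (K + h) z <=
    q * padded_measure (2 / 2 ^+ (K + h)) K l r ->
  rho * potential K l r - (1 - rho) * (2 / 2 ^+ h) / 2 ^+ K <= potential K.+1 l r.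
Proof.
move=> q_le kappa_ge cost_le; apply: le_trans (le_potentialS K l r).
have rhoh_gt0 : 0 < rho ^+ h by rewrite exprn_gt0.
have entering_le : rho ^- h * \sum_(l <= z < r | free K z) cost (K + h) z <=
    (1 - rho) * padded_measure (2 / 2 ^+ (K + h)) K l r.
  rewrite mulrC ler_pdivrMr // (le_trans cost_le) // [leRHS]mulrAC ler_wpM2r //.
  by rewrite padded_measure_ge0 // divr_ge0.
have -> : \sum_(l <= z < r | free K z) (density K.+1 z - (b K z)%:R / D) =
    rho * potential K l r + (1 - rho) * \sum_(l <= z < r | free K z) D^-1
    + kappa * (2 * rho - 1) / 2 ^+ K * \sum_(l <= z < r | free K z) (ends K z)%:R
    - rho ^- h * \sum_(l <= z < r | free K z) cost (K + h) z.
  rewrite /potential !mulr_sumr -sumrN -!big_split /=.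
  by apply: eq_bigr => z _; rewrite densityS.
move: entering_le; rewrite /padded_measure.
set M := \sum_(l <= z < r | _) D^-1; set N := \sum_(l <= z < r | _) _%:R.
move=> entering_le; have N_ge0 : 0 <= N by apply: sumr_ge0.
have -> : (1 - rho) * (2 / 2 ^+ h) / 2 ^+ K =
    (1 - rho) * (M + 2 / 2 ^+ (K + h) * (N + 1))
    - (1 - rho) * M - (1 - rho) * (2 / 2 ^+ h) * (N / 2 ^+ K).
  by rewrite exprD; field; rewrite !expr2_neq0.
have : (1 - rho) * (2 / 2 ^+ h) * (N / 2 ^+ K) <=
    kappa * (2 * rho - 1) * (N / 2 ^+ K).
  by rewrite ler_wpM2r // divr_ge0.
have -> : kappa * (2 * rho - 1) / 2 ^+ K * N =
  kappa * (2 * rho - 1) * (N / 2 ^+ K) by ring.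
lra.
Qed.

End Potential.

Lemma sum_refine (V : nmodType) (f l r : nat) (F : nat -> V) :
  \sum_(f * l <= z < f * r) F z =
    \sum_(l <= y < r) \sum_(0 <= s < f) F (f * y + s)%N.
Proof.
have [rl|/ltnW/subnKC <-] := leqP r l.
  by rewrite !big_geq // leq_mul2l rl orbT.
elim: (r - l)%N => [|n IHn]; first by rewrite addn0 !big_geq.
rewrite addnS big_nat_recr ?leq_addr //= -IHn mulnS addnC.
rewrite (big_cat_nat (n := (f * (l + n))%N)) ?leq_mul2l ?leq_addr ?orbT //=.
congr (_ + _); rewrite -{1}[(f * (l + n))%N]add0n big_addn addKn.
by apply: eq_bigr => s _; rewrite addnC.
Qed.

Lemma potential_refine (R : realFieldType) (b e b' e' : nat -> nat -> nat)
    (D kappa rho : R) (h f K l r : nat) : (0 < f)%N ->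
    (forall i y s, (i < K + h)%N -> (s < f)%N -> b' i (f * y + s)%N = b i y) ->
    (forall i y, (i < K + h)%N -> (\sum_(0 <= s < f) e' i (f * y + s) = e i y)%N) ->
  potential b' e' (f%:R * D) kappa rho h K (f * l) (f * r) =
    potential b e D kappa rho h K l r.
Proof.
move=> f_gt0 b'E e'E; rewrite /potential [LHS]big_mkcond sum_refine [RHS]big_mkcond.
have f_neq0 : f%:R != 0 :> R by rewrite pnatr_eq0 -lt0n.
apply: eq_bigr => y _.
have free' s : (s < f)%N -> free b' K (f * y + s) = free b K y.
  move=> sf; rewrite /free; congr (_ == _)%N; apply: eq_big_nat => i /andP[_ iK].
  by rewrite b'E // ltn_addr.
have ends' : (\sum_(0 <= s < f) ends e' K (f * y + s) = ends e K y)%N.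
  rewrite /ends exchange_big /=; apply: eq_big_nat => i /andP[_ iK].
  by rewrite e'E // ltn_addr.
have cost' i : (i < K + h)%N ->
    \sum_(0 <= s < f) cost b' e' (f%:R * D) kappa i (f * y + s) =
    cost b e D kappa i y.
  move=> iK; rewrite /cost big_split /= -mulr_sumr -natr_sum e'E //; congr (_ + _).
  rewrite (eq_big_nat _ _ (F2 := fun=> (b i y)%:R / (f%:R * D))) => [|s /andP[_ sf]].
    by rewrite sumr_const_nat subn0 -[LHS]mulr_natl invfM mulrCA mulVKf.
  by rewrite b'E.
rewrite (eq_big_nat _ _ (F2 := fun s => if free b K y then
  density b' e' (f%:R * D) kappa rho h K (f * y + s) else 0)) => [|s /andP[_ sf]].
  case: ifP => _; last by rewrite big1.
  rewrite /density !sumrB -mulr_sumr -natr_sum ends' sumr_const_nat subn0.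
  congr (_ - _ - _); first by rewrite -[LHS]mulr_natl invfM mulVKf.
  rewrite /discounted exchange_big /=; apply: eq_big_nat => j /andP[_ jh].
  by rewrite -mulr_sumr cost' // ltn_add2l.
by rewrite free'.
Qed.

(** * Bad cells of a grid *)

Section Grid.
Local Open Scope nat_scope.

(* The unit interval is cut into [E * G] cells. When [t] divides [G], the set of
   points at distance at most [1 / (E * t)] from a multiple of [1 / t] is a union of
   cells, those selected by [bad]. *)
Definition bad (E G t z : nat) : bool := (t * z + G) %% (E * G) < 2 * G.

Definition bad_end (E G t z : nat) : bool := bad E G t z.-1 && ~~ bad E G t z.

Lemma sum_modn_shift (p e : nat) (F : nat -> nat) :
  \sum_(0 <= z < p) F ((z + e) %% p) = \sum_(0 <= r < p) F r.
Proof.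
transitivity (\sum_(e <= z < e + p) F (z %% p)).
  by rewrite -{2}[e]add0n big_addn addKn.
rewrite (@sum_period_shift nat) => [|z]; last by rewrite modnDr.
by apply: eq_big_nat => r /andP[_ rp]; rewrite modn_small.
Qed.

Lemma modn_refine f p y s : 0 < p -> s < f ->
  (f * y + s) %% (f * p) = f * (y %% p) + s.
Proof.
move=> p_gt0 sf; rewrite {1}(divn_eq y p) mulnDr mulnCA -addnA modnMDl modn_small //.
by have := ltn_pmod y p_gt0; nia.
Qed.

Lemma badE E G t z : 0 < t -> t %| G ->
  bad E G t z = ((z + G %/ t) %% (E * (G %/ t)) < 2 * (G %/ t)).
Proof.
move=> t_gt0 /divnK GE; rewrite /bad -{1 2 3}GE [_ %/ _ * t]mulnC.
by rewrite -mulnDr mulnCA -muln_modr mulnCA ltn_pmul2l.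
Qed.

Lemma not_bad_far E G t z n : 2 < E -> 0 < G -> ~~ bad E G t z ->
  G <= t * z - n * (E * G) \/ G <= n * (E * G) - t * z.
Proof.
rewrite /bad -leqNgt => E_gt2 G_gt0 far.
have [|lt_right] := leqP G (t * z - n * (E * G)); first by left.
have [|lt_left] := leqP G (n * (E * G) - t * z); first by right.
have zE : t * z + G = n * (E * G) + (t * z + G - n * (E * G)) by lia.
by move: far; rewrite zE modnMDl modn_small; nia.
Qed.

Section OneDenominator.
Variables (E G t : nat).
Hypotheses (E_gt2 : 2 < E) (G_gt0 : 0 < G) (t_gt0 : 0 < t) (tG : t %| G).
Let e := G %/ t.
Let p := E * e.

Let e_gt0 : 0 < e.
Proof. by rewrite divn_gt0 // dvdn_leq. Qed.

Lemma bad_period_gt0 : 0 < p.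
Proof. by rewrite muln_gt0 e_gt0 andbT; lia. Qed.

Let ep : 2 * e < p.
Proof. by rewrite ltn_mul2r e_gt0. Qed.

Lemma bad_periodic z : bad E G t (z + p) = bad E G t z.
Proof. by rewrite !badE // addnAC modnDr. Qed.

Lemma bad_end_periodic z : bad_end E G t (z + p) = bad_end E G t z.
Proof.
rewrite /bad_end; case: z => [|z]; last by rewrite addSn /= -addSn !bad_periodic.
have bad0 : bad E G t 0.
  by rewrite /bad muln0 add0n modn_small ltn_Pmull // (ltn_trans _ E_gt2).
by rewrite bad_periodic bad0 andbF.
Qed.

Lemma bad_periodic_count : periodic_count (bad E G t) p (2 * e).
Proof.
split; [exact: bad_period_gt0 | exact: bad_periodic |].
under eq_bigr do rewrite badE //.
rewrite (sum_modn_shift p e (fun r => r < 2 * e)).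
apply: (@leq_trans (\sum_(0 <= r < p | r < 2 * e) 1)).
  by rewrite [leqRHS]big_mkcond.
rewrite -(big_nat_widen _ _ _ xpredT) ?(ltnW ep) //.
by rewrite sum_nat_const_nat subn0 muln1.
Qed.

Lemma bad_end_residue z : bad_end E G t z -> (z + e) %% p = 2 * e.
Proof.
rewrite /bad_end; case: z => [|z]; first by rewrite andbN.
rewrite !badE //= -/e -/p -leqNgt addSn -[(z + e).+1]addn1 -[(_ + 1) %% p]modnDml.
by move: ((z + e) %% p) => r /andP[lt_e]; rewrite modn_small; lia.
Qed.

Lemma bad_end_periodic_count : periodic_count (bad_end E G t) p 1.
Proof.
split; [exact: bad_period_gt0 | exact: bad_end_periodic |].
apply: (@leq_trans (\sum_(0 <= z < p) ((z + e) %% p == 2 * e))).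
  apply: leq_sum => z _; case end_z: (bad_end _ _ _ _) => //.
  by rewrite (bad_end_residue end_z) eqxx.
rewrite (sum_modn_shift p e (fun r => r == 2 * e)).
rewrite (bigD1_seq (2 * e)) ?mem_index_iota ?ep ?iota_uniq //= eqxx.
by rewrite big1 ?addn0 // => r /negbTE->.
Qed.

Lemma bad_refine f y s : s < f -> bad E (f * G) t (f * y + s) = bad E G t y.
Proof.
move=> sf; rewrite !badE ?dvdn_mull // -muln_divA // mulnCA addnAC -mulnDr.
rewrite modn_refine ?bad_period_gt0 //; move: (_ %% _) => r; rewrite -/e.
by apply/idP/idP; nia.
Qed.

Lemma sum_bad_end_refine f y : 0 < f ->
  \sum_(0 <= s < f) bad_end E (f * G) t (f * y + s) = bad_end E G t y.
Proof.
move=> f_gt0; rewrite big_ltn // big_nat big1 => [|s /andP[s_gt0 sf]]; last first.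
  have sE : f * y + s = (f * y + s.-1).+1 by rewrite -addnS prednK.
  by rewrite /bad_end {1}sE !bad_refine ?andbN //; lia.
rewrite addn0 /bad_end bad_refine //; case: y => [|y].
  by have := bad_refine 0 f_gt0; rewrite muln0 => ->.
have -> : (f * y.+1 + 0).-1 = f * y + f.-1 by nia.
by rewrite bad_refine // prednK.
Qed.

End OneDenominator.

(* The elements of [T] are put in the octave of [2 ^ h * t], so that the first [h]
   octaves are empty; lengths are accordingly measured in units of [2 ^ h]. *)
Definition octave (h : nat) (T : nat -> bool) (i t : nat) : bool :=
  T t && (2 ^ h * t <= 2 ^ i < 2 * (2 ^ h * t)).

Definition bad_count (h : nat) (T : nat -> bool) (E G i z : nat) : nat :=
  \sum_(0 <= t < (2 ^ i).+1 | octave h T i t) bad E G t z.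

Definition end_count (h : nat) (T : nat -> bool) (E G i z : nat) : nat :=
  \sum_(0 <= t < (2 ^ i).+1 | octave h T i t) bad_end E G t z.

Definition octave_bounded (C h : nat) (T : nat -> bool) : Prop :=
  forall i, \sum_(0 <= t < (2 ^ i).+1 | octave h T i t) 1 <= C.

Section Octaves.
Variables (h : nat) (T : nat -> bool).

Lemma octave_gt0 i t : octave h T i t -> 0 < t.
Proof. by rewrite /octave; case: t => // /and3P[_ _]; rewrite !muln0. Qed.

Lemma octave_leq i t : octave h T i t -> t <= 2 ^ i.
Proof.
by case/and3P=> _ le_t _; rewrite (leq_trans _ le_t) // leq_pmull ?expn_gt0.
Qed.

Lemma octave_small i t : i < h -> octave h T i t = false.
Proof.
move=> ih; apply/negP => oct; have t_gt0 := octave_gt0 oct.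
case/and3P: oct => _ /(leq_trans (leq_pmulr _ t_gt0)).
by rewrite leq_exp2l // leqNgt ih.
Qed.

Lemma octave_exists t : T t -> 0 < t -> exists i, octave h T i t.
Proof.
move=> Tt t_gt0; rewrite /octave Tt; set u := 2 ^ h * t.
have : 0 < u by rewrite muln_gt0 expn_gt0.
case: (ltngtP u 1) => [| u_gt1 _|-> _]; [by case: u | | by exists 0].
have /andP[lt_u le_u] := up_log_bounds (isT : 1 < 2) u_gt1; exists (up_log 2 u).
have log_gt0 : 0 < up_log 2 u by rewrite up_log_gt0.
by rewrite le_u -(prednK log_gt0) expnS ltn_mul2l.
Qed.

Variables (E G : nat).

Lemma free_not_bad K i t z : i < K -> octave h T i t ->
  free (bad_count h T E G) K z -> ~~ bad E G t z.
Proof.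
move=> iK oct; rewrite /free sum_nat_seq_eq0 => /allP /(_ i).
rewrite mem_index_iota iK /= => /(_ isT); rewrite sum_nat_seq_eq0 => /allP /(_ t).
by rewrite mem_index_iota oct eqb0 /= ltnS; apply; apply: octave_leq.
Qed.

Lemma free_run_start K z : free (bad_count h T E G) K z ->
  ~~ free (bad_count h T E G) K z.-1 -> 0 < ends (end_count h T E G) K z.
Proof.
move=> fz; rewrite /free sum_nat_seq_neq0 => /hasP[i iK].
rewrite sum_nat_seq_neq0 => /hasP[t t_le /andP[oct]]; rewrite eqb0 negbK => bad_t.
rewrite lt0n sum_nat_seq_neq0; apply/hasP; exists i => //.
rewrite sum_nat_seq_neq0; apply/hasP; exists t => //.
move: iK; rewrite mem_index_iota oct eqb0 negbK /= => iK.
by rewrite /bad_end bad_t (free_not_bad iK oct fz).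
Qed.

End Octaves.

End Grid.

Section OctaveCost.
Variables (R : realFieldType) (T : nat -> bool) (C E G h : nat) (kappa : R).
Hypotheses (E_gt2 : (2 < E)%N) (G_gt0 : (0 < G)%N) (kappa_ge0 : 0 <= kappa).
Hypothesis T_bounded : octave_bounded C h T.

Let D : R := (2 ^ h * E * G)%:R.
Let b := bad_count h T E G.
Let e := end_count h T E G.

Let D_gt0 : 0 < D.
Proof. by rewrite ltr0n !muln_gt0 expn_gt0 G_gt0 (ltn_trans _ E_gt2). Qed.

Lemma octave_invr i t : octave h T i t ->
  (2 ^+ i)^-1 <= (2 ^+ h * t%:R : R)^-1 <= 2 / 2 ^+ i.
Proof.
move=> oct; have u_gt0 : 0 < 2 ^+ h * t%:R :> R.
  by rewrite mulr_gt0 ?exprn_gt0 // ltr0n (octave_gt0 oct).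
case/and3P: oct => _; rewrite -(ler_nat R) -(ltr_nat R) !natrM !natrX => le_i lt_i.
rewrite lef_pV2 ?posrE ?exprn_gt0 // le_i ler_pdivlMr ?exprn_gt0 //.
by rewrite mulrC ler_pdivrMr // ltW.
Qed.

Lemma denominator_cost_le K i t l r : octave h T i t -> (t %| G)%N ->
  \sum_(l <= z < r | free b K z)
      ((bad E G t z)%:R / D + kappa / 2 ^+ i * (bad_end E G t z)%:R) <=
    (2 / E%:R + kappa) * padded_measure b e D (2 / 2 ^+ i) K l r.
Proof.
move=> oct tG; have t_gt0 := octave_gt0 oct.
have run_start := @free_run_start h T E G K.
have := free_run_measure D_gt0 l r
  (bad_end_periodic_count E_gt2 G_gt0 t_gt0 tG) run_start.
have := free_run_measure D_gt0 l r
  (bad_periodic_count E_gt2 G_gt0 t_gt0 tG) run_start.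
have E_gt0 : 0 < E%:R :> R by rewrite ltr0n (ltn_trans _ E_gt2).
have g_gt0 : 0 < (G %/ t)%:R :> R by rewrite ltr0n divn_gt0 // dvdn_leq.
have -> : (E * (G %/ t))%:R / D = (2 ^+ h * t%:R)^-1.
  rewrite /D -{2}(divnK tG) !natrM natrX; move: (G %/ t)%:R g_gt0 => g g_gt0.
  by field; rewrite !gt_eqF ?exprn_gt0 // ltr0n.
have DE : D = E%:R * (G %/ t)%:R * (2 ^+ h * t%:R).
  by rewrite /D -{1}(divnK tG) !natrM natrX; ring.
have /andP[tau_ge /(padded_measure_le b e D K l r)] := octave_invr oct.
move: (padded_measure _ _ _ _ _ _ _) (padded_measure _ _ _ _ _ _ _) => W V VW.
rewrite natrM mul1r big_split /= -mulr_sumr -mulr_suml => bad_le end_le.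
move: (G %/ t)%:R g_gt0 DE bad_le => g g_gt0 DE bad_le.
rewrite mulrDl lerD //.
  apply: le_trans (ler_wpM2l _ VW); last by rewrite divr_ge0 // ltW.
  have -> : 2 / E%:R * V = 2 * g * V / (E%:R * g) by field; rewrite !gt_eqF.
  rewrite DE invfM mulrCA mulrC ler_wpM2r 1?mulrC //.
  by rewrite invr_ge0 mulr_ge0 // ltW.
rewrite -mulrA ler_wpM2l // (le_trans _ VW) // (le_trans _ end_le) // ler_wpM2r //.
exact: sumr_ge0.
Qed.

Lemma octave_cost_le K i l r : (forall t, octave h T i t -> (t %| G)%N) ->
  \sum_(l <= z < r | free b K z) cost b e D kappa i z <=
    C%:R * (2 / E%:R + kappa) * padded_measure b e D (2 / 2 ^+ i) K l r.
Proof.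
move=> divG; have costE z : cost b e D kappa i z =
    \sum_(0 <= t < (2 ^ i).+1 | octave h T i t)
      ((bad E G t z)%:R / D + kappa / 2 ^+ i * (bad_end E G t z)%:R).
  rewrite /cost /b /e /bad_count /end_count !natr_sum mulr_suml mulr_sumr.
  by rewrite big_split.
under eq_bigr do rewrite costE.
rewrite exchange_big /= -[leRHS]mulrA; set W := _ * padded_measure _ _ _ _ _ _ _.
have W_ge0 : 0 <= W.
  by rewrite mulr_ge0 ?padded_measure_ge0 ?divr_ge0 // addr_ge0 // divr_ge0.
apply: (@le_trans _ _ (\sum_(0 <= t < (2 ^ i).+1 | octave h T i t) 1%:R * W)).
  by apply: ler_sum => t oct; rewrite mul1r denominator_cost_le ?divG.
by rewrite -mulr_suml -natr_sum ler_wpM2r // ler_nat.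
Qed.

End OctaveCost.

(** * Halving *)

Lemma two_decay_steps (R : realFieldType) (rho x u0 u1 u2 : R) :
    7 / 8 <= rho -> 0 <= x -> x <= u0 -> rho * u0 - 1 / 8 * x <= u1 ->
  rho * u1 - 1 / 8 * (x / 2) <= u2 -> x / 2 <= u2.
Proof.
move=> rho_ge x_ge0 u0_ge u1_ge u2_ge.
have u0_decay : 7 / 8 * x <= rho * u0 by apply: ler_pM => //; lra.
have u1_decay : 7 / 8 * (3 / 4 * x) <= rho * u1 by apply: ler_pM => //; lra.
lra.
Qed.

Section Weights.
Variables (R : realFieldType) (E h : nat).

Definition decay : R := h%:R / h.+1%:R.

Definition end_weight : R := (2 * E%:R)^-1.

Lemma onem_decay : 1 - decay = h.+1%:R^-1.
Proof. by rewrite /decay -natr1; field; rewrite natr1. Qed.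

Lemma decay_ge : (7 <= h)%N -> 7 / 8 <= decay.
Proof.
rewrite -(ler_nat R) => h_ge7; rewrite /decay ler_pdivlMr ?ltr0n // -natr1; lra.
Qed.

Lemma end_weight_ge0 : 0 <= end_weight.
Proof. by rewrite invr_ge0 mulr_ge0. Qed.

Definition sustainable (C : nat) : Prop :=
  [/\ (2 < E)%N, (7 <= h)%N,
      C%:R * (2 / E%:R + end_weight) <= (1 - decay) * decay ^+ h &
      (1 - decay) * (2 / 2 ^+ h) <= end_weight * (2 * decay - 1)].

End Weights.

Section NestedIntervals.
Variables (R : realFieldType) (T : nat -> bool) (E h : nat).
Local Notation rho := (decay R h).
Local Notation kappa := (end_weight R E).

Definition grid_potential (G : nat) : nat -> nat -> nat -> R :=
  potential (bad_count h T E G) (end_count h T E G) (2 ^ h * E * G)%:R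
    kappa rho h.

(* Stage [d] works on the intervals [2 ^ h q / 2 ^ d, 2 ^ h (q + 1) / 2 ^ d], cut
   into [width d] cells of length [1 / (E * grid d)], after [2 d] octaves. *)
Definition grid (d : nat) : nat := (2 ^ d * (4 ^ d)`!)%N.

Definition width (d : nat) : nat := (2 ^ h * E * (4 ^ d)`!)%N.

Definition alive (d q : nat) : bool :=
  2 ^- (2 * d) <= grid_potential (grid d) (2 * d) (q * width d) (q.+1 * width d).

Fixpoint digits (d : nat) : nat :=
  if d is d'.+1 then (2 * digits d' + ~~ alive d (2 * digits d'))%N else 0%N.

Lemma digits_step d : (2 * digits d <= digits d.+1 <= (2 * digits d).+1)%N.
Proof. by rewrite /=; case: (alive _ _); rewrite ?addn0 ?addn1 leqnn leqnSn. Qed.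

Lemma grid_gt0 d : (0 < grid d)%N.
Proof. by rewrite muln_gt0 expn_gt0 fact_gt0. Qed.

Lemma octave_dvd_grid d i t : (i <= 2 * d + h)%N -> octave h T i t ->
  (t %| grid d)%N.
Proof.
move=> id oct; rewrite dvdn_mull // dvdn_fact // (octave_gt0 oct) /=.
case/and3P: oct => _ le_t _; rewrite -(@leq_pmul2l (2 ^ h)) ?expn_gt0 //.
by rewrite (leq_trans le_t) // -[4%N]/(2 ^ 2)%N -expnM -expnD leq_exp2l // addnC.
Qed.

Lemma grid_refine d : exists2 f, (0 < f)%N &
  (grid d.+1 = f * grid d /\ f * width d = 2 * width d.+1)%N.
Proof.
have [g factE] : exists g, ((4 ^ d.+1)`! = g * (4 ^ d)`!)%N.
  apply/dvdnP; rewrite -(@bin_fact (4 ^ d.+1) (4 ^ d)); last by rewrite leq_exp2l.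
  by rewrite dvdn_mull // dvdn_mulr.
have := fact_gt0 (4 ^ d.+1); rewrite factE muln_gt0 => /andP[g_gt0 _].
exists (2 * g)%N; first by rewrite muln_gt0.
by rewrite /grid /width factE expnS; split; ring.
Qed.

Variable C : nat.
Hypothesis Eh_sustainable : sustainable R E h C.
Hypothesis T_bounded : octave_bounded C h T.

Let E_gt2 : (2 < E)%N.
Proof. by case: Eh_sustainable. Qed.

Lemma grid_potential_refine f G K l r : (0 < f)%N -> (0 < G)%N ->
    (forall i t, (i < K + h)%N -> octave h T i t -> (t %| G)%N) ->
  grid_potential (f * G) K (f * l) (f * r) = grid_potential G K l r.
Proof.
move=> f_gt0 G_gt0 divG; rewrite /grid_potential mulnCA natrM.
apply: potential_refine => // [i y s iK sf|i y iK].
  apply: eq_bigr => t oct.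
  by rewrite (bad_refine E_gt2 G_gt0 (octave_gt0 oct) (divG _ _ iK oct)).
rewrite exchange_big; apply: eq_bigr => t oct.
by rewrite (sum_bad_end_refine E_gt2 G_gt0 (octave_gt0 oct) (divG _ _ iK oct)).
Qed.

Let rho_ge : 7 / 8 <= rho.
Proof. by apply: decay_ge; case: Eh_sustainable. Qed.

Let rho_gt0 : 0 < rho.
Proof. by apply: lt_le_trans rho_ge; lra. Qed.

Let cells_gt0 G : (0 < G)%N -> 0 < (2 ^ h * E * G)%:R :> R.
Proof. by move=> ?; rewrite ltr0n !muln_gt0 expn_gt0 (ltn_trans _ E_gt2). Qed.

Lemma alive0 : alive 0 0.
Proof.
rewrite /alive /grid_potential potential0 => [|j z jh]; last first.
  by rewrite /bad_count /end_count !big_pred0 // => t; apply: octave_small.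
rewrite mul0n mul1n subn0 /width /grid mul1n divff ?gt_eqF ?cells_gt0 ?fact_gt0 //.
by rewrite muln0 expr0 invr1.
Qed.

Lemma grid_potentialS_ge G K l r : (0 < G)%N ->
    (forall t, octave h T (K + h) t -> (t %| G)%N) ->
  rho * grid_potential G K l r - 1 / 8 * 2 ^- K <= grid_potential G K.+1 l r.
Proof.
case: Eh_sustainable => _ h_ge7 octave_le kappa_ge G_gt0 divG.
have cost_le := octave_cost_le E_gt2 G_gt0 (end_weight_ge0 R E) T_bounded K l r divG.
apply: le_trans (potentialS_ge (cells_gt0 G_gt0) (end_weight_ge0 R E) rho_gt0
  octave_le kappa_ge cost_le).
rewrite lerD2l lerN2 ler_wpM2r ?invr_ge0 ?exprn_ge0 //.
have pow_ge2 : 2 <= 2 ^+ h :> R by rewrite -[leLHS]expr1 ler_eXn2l ?ltr1n //; lia.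
rewrite -[leRHS]mulr1 ler_pM ?divr_ge0 ?exprn_ge0 //.
- by rewrite subr_ge0 ler_pdivrMr // mul1r ler_nat.
- by have := rho_ge; lra.
- by rewrite ler_pdivrMr ?mul1r // (lt_le_trans _ pow_ge2).
Qed.

Lemma alive_split d q : alive d q -> alive d.+1 (2 * q) || alive d.+1 (2 * q).+1.
Proof.
rewrite /alive => live; have [f f_gt0 [gridE widthE]] := grid_refine d.
pose U K l r := grid_potential (grid d.+1) K (l * width d.+1) (r * width d.+1).
have dE : (2 * d.+1 = (2 * d).+2)%N by rewrite mulnS.
have divG K t : (K <= (2 * d).+1)%N -> octave h T (K + h) t -> (t %| grid d.+1)%N.
  by move=> Kd; apply: octave_dvd_grid; rewrite leq_add2r dE leqW.
have U0 : 2 ^- (2 * d) <= U (2 * d)%N (2 * q)%N (2 * q).+2.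
  have dbl m : (2 * m * width d.+1 = f * (m * width d))%N.
    by rewrite mulnCA widthE mulnCA mulnA.
  rewrite /U -[(2 * q).+2]/(2 + 2 * q)%N -mulnS !dbl gridE grid_potential_refine //.
    exact: grid_gt0.
  by move=> i t id; apply: octave_dvd_grid; rewrite ltnW.
have step K : (K <= (2 * d).+1)%N ->
    rho * U K (2 * q)%N (2 * q).+2 - 1 / 8 * 2 ^- K <= U K.+1 (2 * q)%N (2 * q).+2.
  by move=> Kd; apply: grid_potentialS_ge (grid_gt0 _) _ => t; apply: divG.
have halfV n : (2 ^- n) / 2 = 2 ^- n.+1 :> R by rewrite exprSr invfM.
have U2 : 2 ^- (2 * d).+1 <= U (2 * d).+2 (2 * q)%N (2 * q).+2.
  have x_ge0 : 0 <= 2 ^- (2 * d) :> R by rewrite invr_ge0 exprn_ge0.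
  rewrite -halfV; apply: two_decay_steps rho_ge x_ge0 U0 (step _ (leqnSn _)) _.
  by rewrite halfV step.
have Ucat : U (2 * d).+2 (2 * q)%N (2 * q).+2 =
    U (2 * d).+2 (2 * q)%N (2 * q).+1 + U (2 * d).+2 (2 * q).+1 (2 * q).+2.
  by apply: potential_cat; rewrite !leq_mul2r !leqnSn !orbT.
rewrite dE; move: U2; rewrite {}Ucat -[2 ^- (2 * d).+2]halfV.
by rewrite -!/(U _ _ _); case: leP => //= lt1; case: leP => // lt2; lra.
Qed.

Lemma alive_digits d : alive d (digits d).
Proof.
elim: d => [|d IHd]; first exact: alive0.
rewrite /=; have := alive_split IHd.
by case al: (alive d.+1 (2 * digits d)); rewrite /= ?addn0 ?addn1 ?al.
Qed.

Lemma digits_free d :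
  exists2 z, (digits d * width d <= z < (digits d).+1 * width d)%N &
    free (bad_count h T E (grid d)) (2 * d) z.
Proof.
apply: potential_gt0; apply: lt_le_trans (alive_digits d).
by rewrite invr_gt0 exprn_gt0.
Qed.

End NestedIntervals.
(** * Recursive functions *)

Section RecursiveNat.
Local Open Scope nat_scope.

(* [f] only matters on lists of size [n]. In the rules for primitive recursion and
   big operators, the new variable is the head of the list. *)
Definition rec_nat (n : nat) (f : seq nat -> nat) : Prop :=
  recursive (fun v : n.-tuple nat => f v).

Lemma rec_nat_ext n f g : (forall s, size s = n -> f s = g s) ->
  rec_nat n f -> rec_nat n g.
Proof.
move=> fg; rewrite /rec_nat (_ : (fun v : n.-tuple nat => f v) = (fun v => g v)) //.
by apply/funext => v; apply: fg; rewrite size_tuple.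
Qed.

Lemma rec_nat_nth n i : i < n -> rec_nat n (nth 0 ^~ i).
Proof.
move=> lin; have := recursive_proj (Ordinal lin).
by rewrite /rec_nat; congr recursive; apply/funext => v; rewrite (tnth_nth 0).
Qed.

Lemma rec_nat_comp n f (hs : seq (seq nat -> nat)) :
    rec_nat (size hs) f ->
    (forall i, i < size hs -> rec_nat n (nth (fun=> 0) hs i)) ->
  rec_nat n (fun s => f [seq h s | h <- hs]).
Proof.
move=> rf rhs.
have := recursive_comp (h := fun (i : 'I_(size hs)) v => nth (fun=> 0) hs i (val v))
  rf (fun i => rhs i (ltn_ord i)).
rewrite /rec_nat; congr recursive; apply/funext => v; congr f.
apply: (@eq_from_nth _ 0); first by rewrite size_tuple size_map.
move=> i; rewrite size_tuple => ih.
by rewrite -(tnth_nth 0 _ (Ordinal ih)) tnth_mktuple (nth_map (fun=> 0)).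
Qed.

Lemma rec_nat_subst n k f (hs : seq (seq nat -> nat)) :
    rec_nat (size hs + n) f ->
    (forall i, i < size hs -> rec_nat (k + n) (nth (fun=> 0) hs i)) ->
  rec_nat (k + n) (fun s => f ([seq h s | h <- hs] ++ drop k s)).
Proof.
move=> rf rhs.
pose ps := [seq (fun s : seq nat => nth 0 s (k + i)) | i <- iota 0 n].
have szps : size ps = n by rewrite size_map size_iota.
apply: (@rec_nat_ext _ (fun s => f [seq h s | h <- hs ++ ps])) => [s sz|].
  rewrite map_cat; congr (f (_ ++ _)).
  apply: (@eq_from_nth _ 0) => [|i]; rewrite size_map szps ?size_drop ?sz ?addKn //.
  move=> lin; rewrite (nth_map (fun=> 0)) ?szps // nth_drop /ps.
  by rewrite (nth_map 0) ?size_iota // nth_iota.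
apply: rec_nat_comp; rewrite size_cat szps // => i ih; rewrite nth_cat.
case: ifP => [/rhs//|/negbT]; rewrite -leqNgt => hi.
rewrite (nth_map 0) ?size_iota; last by lia.
by rewrite nth_iota; [apply: rec_nat_nth; lia | lia].
Qed.

Lemma rec_nat_head n : rec_nat n.+1 (head 0).
Proof. by apply: rec_nat_ext (rec_nat_nth (ltn0Sn n)) => s _; rewrite nth0. Qed.

Lemma rec_nat_behead n f : rec_nat n f -> rec_nat n.+1 (fun s => f (behead s)).
Proof.
move=> rf; apply: rec_nat_ext (@rec_nat_subst n 1 f [::] rf _) => // s _.
by rewrite drop1.
Qed.

Lemma rec_nat_cons n f a : rec_nat n.+1 f -> rec_nat n a ->
  rec_nat n (fun s => f (a s :: s)).
Proof.
move=> rf ra; apply: rec_nat_ext (@rec_nat_subst n 0 f [:: a] rf _) => [s _|[]//].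
by rewrite drop0.
Qed.

Lemma rec_nat_drop_second n f : rec_nat n.+1 f ->
  rec_nat n.+2 (fun s => f (head 0 s :: behead (behead s))).
Proof.
move=> rf.
apply: rec_nat_ext (@rec_nat_subst n 2 f [:: head 0] rf _) => [s _|[]//= _].
  by rewrite -[2]/(1 + 1) -drop_drop !drop1.
exact: rec_nat_head.
Qed.

Lemma rec_nat_prec n f h g a : rec_nat n f ->
    rec_nat n.+2 (fun s => h (head 0 s) (head 0 (behead s)) (behead (behead s))) ->
    (forall s, g 0 s = f s) -> (forall k s, g k.+1 s = h k (g k s) s) ->
  rec_nat n a -> rec_nat n (fun s => g (a s) s).
Proof.
move=> rf rh g0 gS; apply: (@rec_nat_cons n (fun s => g (head 0 s) (behead s))).
pose h' s := h (head 0 s) (head 0 (behead s)) (behead (behead s)).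
apply: (recursive_prec (f := f \o val) (h := h' \o val) rf rh) => [v|k v].
- exact: g0.
- exact: gS.
Qed.

Lemma rec_nat_comp1 n f a : rec_nat 1 (fun s => f (head 0 s)) -> rec_nat n a ->
  rec_nat n (fun s => f (a s)).
Proof.
by move=> rf ra; apply: (@rec_nat_comp n (fun s => f (head 0 s)) [:: a]) => // -[].
Qed.

Lemma rec_nat_succ n a : rec_nat n a -> rec_nat n (fun s => (a s).+1).
Proof.
apply: rec_nat_comp1; have := recursive_succ; rewrite /rec_nat; congr recursive.
by apply/funext => v; rewrite (tnth_nth 0) nth0.
Qed.

Lemma rec_nat_const n k : rec_nat n (fun=> k).
Proof. by elim: k => [|k IHk]; [exact: recursive_zero | exact: rec_nat_succ]. Qed.

Lemma rec_nat_add n a b :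
  rec_nat n a -> rec_nat n b -> rec_nat n (fun s => a s + b s).
Proof.
move=> ra rb.
apply: (@rec_nat_prec n b (fun _ acc _ => acc.+1) (fun k s => k + b s)) => //.
exact/rec_nat_succ/rec_nat_behead/rec_nat_head.
Qed.

Lemma rec_nat_mul n a b :
  rec_nat n a -> rec_nat n b -> rec_nat n (fun s => a s * b s).
Proof.
move=> ra rb.
apply: (@rec_nat_prec n (fun=> 0) (fun _ acc s => b s + acc)
  (fun k s => k * b s)) => //.
- exact: rec_nat_const.
- apply: rec_nat_add; last exact/rec_nat_behead/rec_nat_head.
  exact/(@rec_nat_behead n.+1 (b \o behead))/rec_nat_behead.
Qed.

Lemma rec_nat_sub n a b :
  rec_nat n a -> rec_nat n b -> rec_nat n (fun s => a s - b s).
Proof.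
move=> ra rb.
apply: (@rec_nat_prec n a (fun _ acc _ => acc.-1) (fun k s => a s - k)) => //.
- apply: (@rec_nat_comp1 _ predn); last exact/rec_nat_behead/rec_nat_head.
  apply: (@rec_nat_prec 1 (fun=> 0) (fun k _ _ => k) (fun k _ => k.-1)) => //;
    [exact: rec_nat_const | exact: rec_nat_head..].
- by move=> s; rewrite subn0.
- by move=> k s; rewrite subnS.
Qed.

Lemma rec_nat_negb n (P : seq nat -> bool) :
  rec_nat n P -> rec_nat n (fun s => ~~ P s).
Proof.
move=> rP; apply: (@rec_nat_ext _ (fun s => 1 - P s)); last first.
  exact: rec_nat_sub (rec_nat_const _ _) _.
by move=> s _; case: (P s).
Qed.

Lemma rec_nat_and n (P Q : seq nat -> bool) :
  rec_nat n P -> rec_nat n Q -> rec_nat n (fun s => P s && Q s).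
Proof.
move=> rP rQ; apply: rec_nat_ext (rec_nat_mul rP rQ) => s _; exact: mulnb.
Qed.

Lemma rec_nat_eq0 n a : rec_nat n a -> rec_nat n (fun s => a s == 0).
Proof.
move=> ra.
apply: (@rec_nat_prec n (fun=> 1) (fun _ _ _ => 0) (fun k _ => k == 0)) => //;
  exact: rec_nat_const.
Qed.

Lemma rec_nat_leq n a b :
  rec_nat n a -> rec_nat n b -> rec_nat n (fun s => a s <= b s).
Proof. by move=> ra rb; apply/rec_nat_eq0/rec_nat_sub. Qed.

Lemma rec_nat_eqn n a b :
  rec_nat n a -> rec_nat n b -> rec_nat n (fun s => a s == b s).
Proof.
move=> ra rb; apply: (@rec_nat_ext _ (fun s => (a s <= b s) && (b s <= a s))).
  by move=> s _; rewrite eqn_leq.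
by apply: rec_nat_and; apply: rec_nat_leq.
Qed.

Lemma rec_nat_if n (P : seq nat -> bool) a b :
    rec_nat n P -> rec_nat n a -> rec_nat n b ->
  rec_nat n (fun s => if P s then a s else b s).
Proof.
move=> rP ra rb; apply: (@rec_nat_ext _ (fun s => P s * a s + ~~ P s * b s)).
  by move=> s _; case: (P s); rewrite ?mul1n ?mul0n ?addn0.
by apply: rec_nat_add; apply: rec_nat_mul => //; apply: rec_nat_negb.
Qed.

Lemma rec_nat_modn n a b :
  rec_nat n a -> rec_nat n b -> rec_nat n (fun s => a s %% b s).
Proof.
move=> ra rb; apply: (@rec_nat_prec n (fun=> 0)
  (fun _ r s => if r.+1 == b s then 0 else r.+1) (fun k s => k %% b s)) => //.
- exact: rec_nat_const.
- apply: rec_nat_if; [apply: rec_nat_eqn | exact: rec_nat_const |].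
  + exact/rec_nat_succ/rec_nat_behead/rec_nat_head.
  + exact/(@rec_nat_behead n.+1 (b \o behead))/rec_nat_behead.
  + exact/rec_nat_succ/rec_nat_behead/rec_nat_head.
- by move=> s; rewrite mod0n.
move=> k s; rewrite modnS; congr (if _ then _ else _).
have [->|b_gt0] := posnP (b s); first by rewrite dvd0n.
rewrite /dvdn -[k.+1]addn1 -modnDml addn1; have := ltn_pmod k b_gt0.
move: (k %% b s) => r; rewrite leq_eqVlt => /predU1P[->|lt].
  by rewrite modnn !eqxx.
by rewrite modn_small // (ltn_eqF lt).
Qed.

Lemma rec_nat_bigop (idx : nat) (op : Monoid.law idx) :
    (forall m a b,
      rec_nat m a -> rec_nat m b -> rec_nat m (fun s => op (a s) (b s))) ->
  forall n (P : nat -> seq nat -> bool) F a b,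
    rec_nat n.+1 (fun s => P (head 0 s) (behead s)) ->
    rec_nat n.+1 (fun s => F (head 0 s) (behead s)) ->
    rec_nat n a -> rec_nat n b ->
  rec_nat n (fun s => \big[op/idx]_(a s <= i < b s | P i s) F i s).
Proof.
move=> rop n P F a b rP rF ra rb.
pose F' i s := if P i s && (a s <= i) then F i s else idx.
have rF' : rec_nat n.+1 (fun s => F' (head 0 s) (behead s)).
  apply: rec_nat_if => //; last exact: rec_nat_const.
  apply: rec_nat_and => //; apply: rec_nat_leq (rec_nat_head n).
  exact: rec_nat_behead.
apply: (@rec_nat_ext _ (fun s => \big[op/idx]_(0 <= i < b s) F' i s)).
  by move=> s _; rewrite [RHS](big_nat_widenl _ 0) // [RHS]big_mkcond.
apply: (@rec_nat_prec n (fun=> idx) (fun k acc s => op acc (F' k s))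
  (fun m s => \big[op/idx]_(0 <= i < m) F' i s) b) => //.
- exact: rec_nat_const.
- by apply: rop (rec_nat_drop_second rF'); apply/rec_nat_behead/rec_nat_head.
- by move=> s; rewrite big_geq.
- by move=> k s; rewrite big_nat_recr.
Qed.

Lemma rec_nat_sum n (P : nat -> seq nat -> bool) F a b :
    rec_nat n.+1 (fun s => P (head 0 s) (behead s)) ->
    rec_nat n.+1 (fun s => F (head 0 s) (behead s)) ->
    rec_nat n a -> rec_nat n b ->
  rec_nat n (fun s => \sum_(a s <= i < b s | P i s) F i s).
Proof. exact: rec_nat_bigop rec_nat_add _ _ _ _ _. Qed.

Lemma rec_nat_prod n (P : nat -> seq nat -> bool) F a b :
    rec_nat n.+1 (fun s => P (head 0 s) (behead s)) ->
    rec_nat n.+1 (fun s => F (head 0 s) (behead s)) ->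
    rec_nat n a -> rec_nat n b ->
  rec_nat n (fun s => \prod_(a s <= i < b s | P i s) F i s).
Proof. exact: rec_nat_bigop rec_nat_mul _ _ _ _ _. Qed.

End RecursiveNat.

Lemma computable_fun_rec_nat f :
  computable_fun f <-> rec_nat 1 (fun s => f (head 0%N s)).
Proof.
rewrite /computable_fun /rec_nat.
suff -> : (fun v : 1.-tuple nat => f (tnth v ord0)) = (fun v => f (head 0%N v)) by [].
by apply/funext => v; rewrite (tnth_nth 0%N) nth0.
Qed.

Create HintDb recursion.

#[local] Hint Resolve rec_nat_head rec_nat_behead rec_nat_const rec_nat_succ
  rec_nat_add rec_nat_mul rec_nat_sub rec_nat_negb rec_nat_and rec_nat_leq
  rec_nat_eqn rec_nat_modn rec_nat_sum rec_nat_prod : recursion.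

Lemma rec_nat_expn n a b :
  rec_nat n a -> rec_nat n b -> rec_nat n (fun s => a s ^ b s)%N.
Proof.
move=> ra rb; apply: (@rec_nat_ext _ (fun s => \prod_(0 <= i < b s) a s)%N).
  by move=> s _; rewrite prod_nat_const_nat subn0.
by auto with recursion.
Qed.

Lemma rec_nat_fact n a : rec_nat n a -> rec_nat n (fun s => (a s)`!).
Proof.
move=> ra; apply: (@rec_nat_ext _ (fun s => \prod_(1 <= i < (a s).+1) i)%N).
  by move=> s _; rewrite fact_prod.
by auto with recursion.
Qed.

#[local] Hint Resolve rec_nat_expn rec_nat_fact : recursion.

Section RecursiveRat.
Variable R : realFieldType.

Definition rec_rat (n : nat) (f : seq nat -> R) : Prop :=
  exists a b c, [/\ rec_nat n a, rec_nat n b, rec_nat n c &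
    forall s, (0 < c s)%N /\ f s = ((a s)%:R - (b s)%:R) / (c s)%:R].

Let pnatr_neq0 c : (0 < c)%N -> c%:R != 0 :> R.
Proof. by rewrite pnatr_eq0 -lt0n. Qed.

Lemma rec_rat_nat n a : rec_nat n a -> rec_rat n (fun s => (a s)%:R).
Proof.
move=> ra; exists a, (fun=> 0%N), (fun=> 1%N); split; auto 10 with recursion.
by move=> s; rewrite subr0 divr1.
Qed.

Lemma rec_rat_natV n a : (forall s, (0 < a s)%N) -> rec_nat n a ->
  rec_rat n (fun s => (a s)%:R^-1).
Proof.
move=> a_gt0 ra; exists (fun=> 1%N), (fun=> 0%N), a; split; auto 10 with recursion.
by move=> s; rewrite subr0 div1r.
Qed.

Lemma rec_rat_add n f g :
  rec_rat n f -> rec_rat n g -> rec_rat n (fun s => f s + g s).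
Proof.
move=> [a [b [c [ra rb rc fE]]]] [a' [b' [c' [ra' rb' rc' gE]]]].
exists (fun s => a s * c' s + a' s * c s)%N, (fun s => b s * c' s + b' s * c s)%N,
  (fun s => c s * c' s)%N; split; auto 10 with recursion.
move=> s; have [c_gt0 ->] := fE s; have [c'_gt0 ->] := gE s.
by rewrite muln_gt0 c_gt0 !natrD !natrM; split=> //; field; rewrite !pnatr_neq0.
Qed.

Lemma rec_rat_opp n f : rec_rat n f -> rec_rat n (fun s => - f s).
Proof.
move=> [a [b [c [ra rb rc fE]]]]; exists b, a, c; split=> // s.
by have [c_gt0 ->] := fE s; rewrite -mulNr opprB.
Qed.

Lemma rec_rat_mul n f g :
  rec_rat n f -> rec_rat n g -> rec_rat n (fun s => f s * g s).
Proof.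
move=> [a [b [c [ra rb rc fE]]]] [a' [b' [c' [ra' rb' rc' gE]]]].
exists (fun s => a s * a' s + b s * b' s)%N, (fun s => a s * b' s + b s * a' s)%N,
  (fun s => c s * c' s)%N; split; auto 10 with recursion.
move=> s; have [c_gt0 ->] := fE s; have [c'_gt0 ->] := gE s.
by rewrite muln_gt0 c_gt0 !natrD !natrM; split=> //; field; rewrite !pnatr_neq0.
Qed.

Lemma rec_rat_sum n (P : nat -> seq nat -> bool) F a b :
    rec_nat n.+1 (fun s => P (head 0%N s) (behead s)) ->
    rec_rat n.+1 (fun s => F (head 0%N s) (behead s)) ->
    rec_nat n a -> rec_nat n b ->
  rec_rat n (fun s => \sum_(a s <= i < b s | P i s) F i s).
Proof.
move=> rP [p [q [c [rp rq rc FE]]]] ra rb.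
pose num (u : seq nat -> nat) s := (\sum_(a s <= i < b s | P i s)
  u (i :: s) * \prod_(a s <= j < b s | j != i) c (j :: s))%N.
have consE u : rec_nat n.+1 u -> rec_nat n.+1 (fun s => u (head 0%N s :: behead s)).
  by apply: rec_nat_ext => -[].
have rnum u : rec_nat n.+1 u -> rec_nat n (num u).
  by have := rec_nat_drop_second rc; rewrite /num; auto 10 with recursion.
exists (num p), (num q), (fun s => \prod_(a s <= i < b s) c (i :: s))%N.
split; auto 10 with recursion.
move=> s; have c_gt0 i : (0 < c (i :: s))%N by have [] := FE (i :: s).
split; first by rewrite prodn_gt0.
rewrite /num !natr_sum -sumrB mulr_suml [LHS]big_nat_cond [RHS]big_nat_cond.
apply: eq_bigr => i /andP[iab _]; have [_ /= ->] := FE (i :: s).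
rewrite [in RHS](bigD1_seq i) ?mem_index_iota ?iota_uniq //= !natrM -mulrBl.
by rewrite -mulf_div divff ?mulr1 // pnatr_neq0 // prodn_gt0.
Qed.

Lemma rec_nat_ler n f g :
  rec_rat n f -> rec_rat n g -> rec_nat n (fun s => f s <= g s).
Proof.
move=> [a [b [c [ra rb rc fE]]]] [a' [b' [c' [ra' rb' rc' gE]]]].
apply: (@rec_nat_ext _
  (fun s => a s * c' s + b' s * c s <= a' s * c s + b s * c' s)%N).
  move=> s _; have [c_gt0 ->] := fE s; have [c'_gt0 ->] := gE s.
  rewrite ler_pdivrMr ?ltr0n // mulrAC ler_pdivlMr ?ltr0n //.
  rewrite -(ler_nat R) !natrD !natrM.
  by congr nat_of_bool; apply/idP/idP; lra.
by auto with recursion.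
Qed.

End RecursiveRat.

#[local] Hint Resolve rec_rat_nat rec_rat_natV rec_rat_add rec_rat_opp rec_rat_mul
  rec_rat_sum : recursion.

Section RecursiveDigits.
Variables (R : realFieldType) (T : nat -> bool) (E h : nat).
Hypotheses (E_gt0 : (0 < E)%N) (h_gt0 : (0 < h)%N).
Hypothesis rec_T : forall n a, rec_nat n a -> rec_nat n (fun s => T (a s)).

Lemma rec_nat_octave n i t : rec_nat n i -> rec_nat n t ->
  rec_nat n (fun s => octave h T (i s) (t s)).
Proof. by rewrite /octave; auto 10 with recursion. Qed.

Lemma rec_nat_bad n G t z : rec_nat n G -> rec_nat n t -> rec_nat n z ->
  rec_nat n (fun s => bad E (G s) (t s) (z s)).
Proof. by rewrite /bad; auto 10 with recursion. Qed.

Lemma rec_nat_bad_end n G t z : rec_nat n G -> rec_nat n t -> rec_nat n z ->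
  rec_nat n (fun s => bad_end E (G s) (t s) (z s)).
Proof.
move=> rG rt rz; rewrite /bad_end.
have rz1 : rec_nat n (fun s => (z s).-1).
  by under eq_fun do rewrite -subn1; auto with recursion.
by apply: rec_nat_and; [|apply: rec_nat_negb]; apply: rec_nat_bad.
Qed.

#[local] Hint Resolve rec_nat_octave rec_nat_bad rec_nat_bad_end : recursion.

Lemma rec_nat_bad_count n G i z : rec_nat n G -> rec_nat n i -> rec_nat n z ->
  rec_nat n (fun s => bad_count h T E (G s) (i s) (z s)).
Proof. by rewrite /bad_count; auto 10 with recursion. Qed.

Lemma rec_nat_end_count n G i z : rec_nat n G -> rec_nat n i -> rec_nat n z ->
  rec_nat n (fun s => end_count h T E (G s) (i s) (z s)).
Proof. by rewrite /end_count; auto 10 with recursion. Qed.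

#[local] Hint Resolve rec_nat_bad_count rec_nat_end_count : recursion.

Lemma rec_rat_decayV n j : rec_nat n j -> rec_rat n (fun s => decay R h ^- j s).
Proof.
move=> rj; under eq_fun do rewrite /decay expr_div_n invf_div -!natrX.
by apply: rec_rat_mul; [|apply: rec_rat_natV => [s|]];
  rewrite ?expn_gt0 ?h_gt0 //; auto with recursion.
Qed.

Lemma rec_rat_expr2V n i : rec_nat n i -> rec_rat n (fun s => 2 ^- i s : R).
Proof.
move=> ri; under eq_fun do rewrite -natrX.
by apply: rec_rat_natV => [s|]; rewrite ?expn_gt0 //; auto with recursion.
Qed.

Lemma rec_rat_end_weight n : rec_rat n (fun=> end_weight R E).
Proof.
under eq_fun do rewrite /end_weight -natrM.
by apply: rec_rat_natV => [s|]; rewrite ?muln_gt0 //; auto with recursion.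
Qed.

#[local] Hint Resolve rec_rat_decayV rec_rat_expr2V rec_rat_end_weight : recursion.

Lemma rec_nat_free n G K z : rec_nat n G -> rec_nat n K -> rec_nat n z ->
  rec_nat n (fun s => free (bad_count h T E (G s)) (K s) (z s)).
Proof. by rewrite /free; auto 10 with recursion. Qed.

Lemma rec_nat_ends n G K z : rec_nat n G -> rec_nat n K -> rec_nat n z ->
  rec_nat n (fun s => ends (end_count h T E (G s)) (K s) (z s)).
Proof. by rewrite /ends; auto 10 with recursion. Qed.

Lemma rec_rat_cellV n G : (forall s, 0 < G s)%N -> rec_nat n G ->
  rec_rat n (fun s => (2 ^ h * E * G s)%:R^-1 : R).
Proof.
move=> G_gt0 rG; apply: rec_rat_natV; auto with recursion.
by move=> s; rewrite !muln_gt0 expn_gt0 E_gt0 G_gt0.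
Qed.

#[local] Hint Resolve rec_nat_free rec_nat_ends rec_rat_cellV : recursion.

Lemma rec_rat_cost n G i z : (forall s, 0 < G s)%N ->
    rec_nat n G -> rec_nat n i -> rec_nat n z ->
  rec_rat n (fun s => cost (bad_count h T E (G s)) (end_count h T E (G s))
    (2 ^ h * E * G s)%:R (end_weight R E) (i s) (z s)).
Proof. by rewrite /cost; auto 10 with recursion. Qed.

#[local] Hint Resolve rec_rat_cost : recursion.

Lemma rec_rat_density n G K z : (forall s, 0 < G s)%N ->
    rec_nat n G -> rec_nat n K -> rec_nat n z ->
  rec_rat n (fun s => density (bad_count h T E (G s)) (end_count h T E (G s))
    (2 ^ h * E * G s)%:R (end_weight R E) (decay R h) h (K s) (z s)).
Proof.
by rewrite /density /discounted; auto 10 with recursion.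
Qed.

#[local] Hint Resolve rec_rat_density : recursion.

Lemma rec_rat_grid_potential n G K l r : (forall s, 0 < G s)%N ->
    rec_nat n G -> rec_nat n K -> rec_nat n l -> rec_nat n r ->
  rec_rat n (fun s => grid_potential R T E h (G s) (K s) (l s) (r s)).
Proof. by rewrite /grid_potential /potential; auto 10 with recursion. Qed.

Lemma rec_nat_grid n d : rec_nat n d -> rec_nat n (fun s => grid (d s)).
Proof. by rewrite /grid; auto 10 with recursion. Qed.

Lemma rec_nat_width n d : rec_nat n d -> rec_nat n (fun s => width E h (d s)).
Proof. by rewrite /width; auto 10 with recursion. Qed.

#[local] Hint Resolve rec_nat_grid rec_nat_width grid_gt0 rec_rat_grid_potential
  : recursion.

Lemma rec_nat_alive n d q : rec_nat n d -> rec_nat n q ->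
  rec_nat n (fun s => alive R T E h (d s) (q s)).
Proof. by move=> rd rq; apply: rec_nat_ler; auto 10 with recursion. Qed.

#[local] Hint Resolve rec_nat_alive : recursion.

Lemma rec_nat_digits n d : rec_nat n d -> rec_nat n (fun s => digits R T E h (d s)).
Proof.
apply: (@rec_nat_prec n (fun=> 0)%N
  (fun d q _ => 2 * q + ~~ alive R T E h d.+1 (2 * q))%N
  (fun d _ => digits R T E h d)) => //; auto 10 with recursion.
Qed.

End RecursiveDigits.

Lemma computable_digits (R : realFieldType) (T : set nat) (E h : nat) :
    (0 < E)%N -> (0 < h)%N -> computable_set T ->
  computable_fun (digits R (fun t => `[< T t >]) E h).
Proof.
move=> E_gt0 h_gt0 T_comp; apply/computable_fun_rec_nat.
apply: rec_nat_digits (rec_nat_head 0) => // n a.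
apply: (@rec_nat_comp1 n (fun t => `[< T t >])).
exact/(computable_fun_rec_nat (fun t => `[< T t >])).
Qed.

(** * Numerical bounds *)

Section ChoiceOfConstants.
Variable R : realType.

Lemma expR1_le3 : expR 1 <= 3 :> R.
Proof.
have -> : 1 = 8%:R * (1 / 8) :> R by field.
rewrite expRM_natl -[expR _]invrK -expRN.
have := expR_ge1Dx (- (1 / 8) : R); set y := expR _ => y_ge.
rewrite exprVn -[leRHS]invrK lef_pV2 ?posrE ?exprn_gt0 ?invr_gt0 ?expR_gt0 //.
have : (7 / 8) ^+ 8 <= y ^+ 8 by rewrite ler_pXn2r ?nnegrE ?expR_ge0 //; lra.
apply: le_trans; lra.
Qed.

Lemma decay_exp_ge h : (0 < h)%N -> 1 / 3 <= decay R h ^+ h.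
Proof.
move=> h_gt0; have h_gt0' : 0 < h%:R :> R by rewrite ltr0n.
rewrite div1r -[leRHS]invrK lef_pV2 ?posrE ?invr_gt0 ?exprn_gt0 ?divr_gt0 //.
rewrite -exprVn invf_div -natr1 mulrDl divff ?gt_eqF // mul1r.
rewrite (le_trans _ expR1_le3) //.
rewrite -[X in expR X](@divff _ h%:R) ?gt_eqF // expRM_natl.
by rewrite ler_pXn2r ?nnegrE ?expR_ge0 ?expR_ge1Dx ?addr_ge0 ?invr_ge0.
Qed.

Variables (C l : nat).
Hypotheses (C_gt0 : (0 < C)%N) (l_gt0 : (0 < l)%N).
Let E := (63 * C * l)%N.
Let h := (8 * l).-1.

Let hS : h.+1 = (8 * l)%N.
Proof. by rewrite prednK // muln_gt0. Qed.

Let C_gt0' : 0 < C%:R :> R.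
Proof. by rewrite ltr0n. Qed.

Let l_gt0' : 0 < l%:R :> R.
Proof. by rewrite ltr0n. Qed.

(* The constant 63 is chosen for [2 / 63 + 1 / 126 <= 1 / 24]. *)
Lemma octave_cost_small :
  C%:R * (2 / E%:R + end_weight R E) <= (1 - decay R h) * decay R h ^+ h.
Proof.
have h_gt0 : (0 < h)%N by rewrite /h; lia.
rewrite onem_decay hS.
apply: (@le_trans _ _ ((8 * l)%:R^-1 * (1 / 3))); last first.
  by rewrite ler_wpM2l ?invr_ge0 // decay_exp_ge.
have -> : C%:R * (2 / E%:R + end_weight R E) = (2 / 63 + 1 / 126) / l%:R.
  by rewrite /end_weight /E !natrM; field; rewrite !gt_eqF.
have -> : (8 * l)%:R^-1 * (1 / 3) = (1 / 24) / l%:R :> R.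
  by rewrite natrM; field; rewrite gt_eqF.
by rewrite ler_wpM2r ?invr_ge0 ?ltW //; lra.
Qed.

Hypothesis C_lt : (C < 2 ^ l.+1)%N.

Lemma leq_mul84_expn2 : (84 * C <= 2 ^ (8 * l))%N.
Proof.
move: C_lt; rewrite expnS [(8 * l)%N]mulnC expnM.
case: (ltngtP l 1) l_gt0 => [|l_gt1 _|-> _].
- by case: l.
- have : (2 ^ 2 <= 2 ^ l)%N by rewrite leq_exp2l.
  move: (2 ^ l)%N => y y_ge4 C_lt'; apply: (@leq_trans (168 * y)%N); first by lia.
  rewrite expnSr leq_mul2r; apply/orP; right.
  by apply: (@leq_trans (4 ^ 7)%N); last by rewrite leq_exp2r.
- by rewrite expn1 /=; lia.
Qed.

Lemma end_weight_large :
  (1 - decay R h) * (2 / 2 ^+ h) <= end_weight R E * (2 * decay R h - 1).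
Proof.
have h_ge7 : (7 <= h)%N by rewrite /h; lia.
have rho_ge := decay_ge R h_ge7.
apply: (@le_trans _ _ (end_weight R E * (3 / 4))); last first.
  by rewrite ler_wpM2l ?end_weight_ge0 //; lra.
have pow_ge : 84 * C%:R <= 2 ^+ (8 * l) :> R.
  by rewrite -natrX -natrM ler_nat leq_mul84_expn2.
rewrite onem_decay hS; have -> : 2 ^+ h = 2 ^+ (8 * l) / 2 :> R.
  by rewrite -hS exprSr mulfK.
have pow_gt0 : 0 < 2 ^+ (8 * l) :> R by rewrite exprn_gt0.
have -> : (8 * l)%:R^-1 * (2 / (2 ^+ (8 * l) / 2)) =
    (2 * l%:R * 2 ^+ (8 * l))^-1 :> R.
  by rewrite natrM; field; rewrite !gt_eqF.
have -> : end_weight R E * (3 / 4) = (2 * l%:R * (84 * C%:R))^-1.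
  by rewrite /end_weight /E !natrM; field; rewrite !gt_eqF.
by rewrite lef_pV2 ?posrE ?mulr_gt0 // ler_pM2l ?mulr_gt0.
Qed.

Lemma sustainable_log : sustainable R E h C.
Proof.
split; [|by rewrite /h; lia|exact: octave_cost_small|exact: end_weight_large].
by rewrite /E -mulnA (@leq_trans 63) // leq_pmulr // muln_gt0 C_gt0.
Qed.

End ChoiceOfConstants.

(** * The limit point *)

Lemma nested_intervals (R : realType) (lo hi : nat -> R) :
    nondecreasing_seq lo -> nonincreasing_seq hi -> (forall d, lo d <= hi d) ->
  exists x, forall d, lo d <= x <= hi d.
Proof.
move=> lo_nd hi_ni lo_hi.
have lo_le_hi d d' : lo d <= hi d'.
  rewrite (le_trans (lo_nd _ _ (leq_maxl d d'))) // (le_trans (lo_hi _)) //.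
  by rewrite hi_ni // leq_maxr.
exists (sup (range lo)) => d; apply/andP; split.
  by apply: ub_le_sup; [exists (hi d) => _ [d' _ <-] | exists d].
by apply: ge_sup => [|_ [d' _ <-]//]; exists (lo d), d.
Qed.

Definition dyadic_limit (R : realFieldType) (c : R) (a : nat -> nat) (x : R) : Prop :=
  forall d, c * (a d)%:R / 2 ^+ d <= x <= c * (a d).+1%:R / 2 ^+ d.

Lemma dyadic_limit_exists (R : realType) (c : R) (a : nat -> nat) : 0 <= c ->
    (forall d, (2 * a d <= a d.+1 <= (2 * a d).+1)%N) ->
  exists x, dyadic_limit c a x.
Proof.
move=> c_ge0 aS.
have scale (m : nat) d : c * m%:R / 2 ^+ d = c * (2 * m)%:R / 2 ^+ d.+1.
  by rewrite natrM exprS; field; rewrite expf_neq0.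
have mono (m n : nat) d : (m <= n)%N -> c * m%:R / 2 ^+ d <= c * n%:R / 2 ^+ d.
  by move=> mn; rewrite ler_wpM2r ?invr_ge0 ?exprn_ge0 // ler_wpM2l // ler_nat.
apply: nested_intervals => [||d].
- by apply/nondecreasing_seqP => d; rewrite scale mono //; case/andP: (aS d).
- by apply/nonincreasing_seqP => d; rewrite [leRHS]scale mono //; have := aS d; lia.
- by rewrite mono.
Qed.

Lemma computable_dyadic_limit (R : realType) (h : nat) (a : nat -> nat) (x : R) :
  computable_fun a -> dyadic_limit (2 ^+ h) a x -> computable_real x.
Proof.
move=> /computable_fun_rec_nat a_rec ax.
exists (fun=> 0%N), (fun d => a (d + h)%N), (fun d => 2 ^ d)%N; split.
- exact/computable_fun_rec_nat/rec_nat_const.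
- by apply/computable_fun_rec_nat; apply: rec_nat_comp1 a_rec _; auto with recursion.
- by apply/computable_fun_rec_nat; auto with recursion.
- by move=> d; apply/eqP; rewrite -lt0n expn_gt0.
move=> d; have := ax (d + h)%N; rewrite expr0 mul1r natrX.
have scale (m : nat) : 2 ^+ h * m%:R / 2 ^+ (d + h) = m%:R / 2 ^+ d :> R.
  by rewrite exprD; field; rewrite !expf_neq0.
by rewrite !scale -[(a _).+1%:R]natr1 mulrDl mul1r ler_norml; lra.
Qed.

Lemma dist_int_ge (R : realType) (c x : R) :
  (forall j : int, c <= `|x - j%:~R|) -> c <= dist_int x.
Proof.
move=> c_le; apply: lb_le_inf; first by exists `|x - 0%:~R|; exists 0.
by move=> _ [j _ <-].
Qed.

Lemma not_bad_dist (R : realFieldType) (E G t z : nat) (j : int) :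
    (2 < E)%N -> (0 < G)%N -> ~~ bad E G t z ->
  E%:R^-1 <= `|t%:R * (z%:R / (E * G)%:R) - j%:~R| :> R.
Proof.
move=> E_gt2 G_gt0 nb.
have D_gt0 : 0 < (E * G)%:R :> R by rewrite ltr0n muln_gt0 G_gt0 (ltn_trans _ E_gt2).
have -> : t%:R * (z%:R / (E * G)%:R) - j%:~R =
    ((t * z)%:Z - j * (E * G)%:Z)%:~R / (E * G)%:R :> R.
  by rewrite intrB intrM -!pmulrn [(t * z)%:R]natrM mulrBl mulfK ?gt_eqF // mulrA.
rewrite normrM normfV (gtr0_norm D_gt0) ler_pdivlMr //.
have -> : E%:R^-1 * (E * G)%:R = G%:Z%:~R :> R.
  by rewrite natrM mulKf // pnatr_eq0; lia.
rewrite -intr_norm ler_int; case: j => j; last by rewrite NegzE; nia.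
by have [] := not_bad_far j E_gt2 G_gt0 nb; lia.
Qed.

Lemma cell_position (R : realFieldType) (E h d q z : nat) : (0 < E)%N ->
    (q * width E h d <= z < q.+1 * width E h d)%N ->
  2 ^+ h * q%:R / 2 ^+ d <= z%:R / (E * grid d)%:R :> R /\
  z%:R / (E * grid d)%:R <= 2 ^+ h * q.+1%:R / 2 ^+ d :> R.
Proof.
move=> E_gt0 /andP[lez /ltnW zle].
have D_gt0 : 0 < (E * grid d)%:R :> R by rewrite ltr0n muln_gt0 E_gt0 grid_gt0.
have widthE m : 2 ^+ h * m%:R / 2 ^+ d * (E * grid d)%:R = (m * width E h d)%:R :> R.
  by rewrite /width /grid !natrM !natrX; field; rewrite expf_neq0.
by rewrite ler_pdivlMr // ler_pdivrMr // !widthE !ler_nat.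
Qed.

Lemma digits_regular (R : realType) (T : nat -> bool) (C E h t : nat) (x : R) :
    sustainable R E h C -> octave_bounded C h T ->
    dyadic_limit (2 ^+ h) (digits R T E h) x -> T t -> (0 < t)%N ->
  E%:R^-1 <= dist_int (t%:R * x).
Proof.
move=> Eh_sustainable T_bounded x_digits Tt t_gt0.
have E_gt2 : (2 < E)%N by case: Eh_sustainable.
have [i oct] := octave_exists h Tt t_gt0.
apply: dist_int_ge => j; apply/ler_addgt0Pr => e e_gt0.
pose d := maxn i.+1 (Num.Def.archi_bound (2 ^+ h * t%:R / e)).
have [z z_cell z_free] := digits_free Eh_sustainable T_bounded d.
have z_far : ~~ bad E (grid d) t z.
  by apply: free_not_bad oct z_free; rewrite /d; lia.
apply: le_trans (not_bad_dist R j E_gt2 (grid_gt0 d) z_far) _.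
have [] := cell_position R (ltn_trans _ E_gt2) z_cell => //.
have /andP[] := x_digits d.
move: (z%:R / _) => y.
rewrite -[(digits R T E h d).+1%:R]natr1 mulrDr mulr1 mulrDl.
move: (_ * _ / _) => lo lo_x x_hi lo_y y_hi.
have xy_near : `|x - y| <= 2 ^+ h / 2 ^+ d by rewrite ler_norml; lra.
have -> : t%:R * y - j%:~R = (t%:R * x - j%:~R) - t%:R * (x - y) by ring.
rewrite (le_trans (ler_normB _ _)) // lerD2l normrM ger0_norm //.
rewrite (le_trans (ler_wpM2l (ler0n _ t) xy_near)) //.
rewrite mulrCA mulrA ler_pdivrMr ?exprn_gt0 // [leRHS]mulrC -ler_pdivrMr // ltW //.
by apply: upper_nthrootP; rewrite leq_maxr.
Qed.

Lemma octave_bounded_sparse (R : realType) (C h : nat) (T : set nat) :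
    (forall j : int, T `&` dyadic_interval R j #<= `I_C) ->
  octave_bounded C h (fun t => `[< T t >]).
Proof.
move=> T_sparse i; set P := octave _ _ i.
pose j : int := i%:Z - h%:Z - 1.
have two_j : 2 ^ (j + 1) = 2 ^+ i / 2 ^+ h :> R.
  by rewrite subrK expfzDr // -exprnP -exprnN.
have two_j_half : 2 ^ j = 2 ^+ i / 2 ^+ h / 2 :> R.
  by rewrite -two_j [X in X / 2]expfzDr // mulfK.
pose s := [seq t <- index_iota 0 (2 ^ i).+1 | P t].
have /pcard_leP/unsquash f := T_sparse j.
rewrite sum1_count -size_filter -/s.
have sub t : t \in s -> (T `&` dyadic_interval R j) t.
  rewrite mem_filter => /andP[/and3P[/asboolP Tt le_i lt_i] _]; split => //.
  rewrite /dyadic_interval /= two_j two_j_half.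
  rewrite ltr_pdivrMr // ltr_pdivrMr ?exprn_gt0 // ler_pdivlMr ?exprn_gt0 //.
  by rewrite -!natrX -!natrM ltr_nat ler_nat; apply/andP; split; lia.
rewrite -(size_map f) -[leqRHS](size_iota 0); apply: uniq_leq_size.
  rewrite map_inj_in_uniq ?filter_uniq ?iota_uniq // => t u ts us.
  by apply: 'inj_f; rewrite inE; apply: sub.
move=> _ /mapP[t ts ->]; rewrite mem_iota add0n.
exact: (@funS _ _ _ _ f _ (sub _ ts)).
Qed.

Lemma eps_lt_trunc_log (R : realType) (C : nat) : (2 <= C)%N ->
  1 / (64 * C%:R * log2 C%:R) < (63 * C * trunc_log 2 C)%:R^-1 :> R.
Proof.
move=> C_ge2; set l := trunc_log 2 C.
have l_gt0 : 0 < l%:R :> R by rewrite ltr0n trunc_log_gt0.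
have C_gt0 : 0 < C%:R :> R by rewrite ltr0n (leq_trans _ C_ge2).
have l_le : l%:R <= log2 C%:R :> R.
  rewrite /log2 ler_pdivlMr ?ln_gt0 ?ltr1n // mulr_natl -lnXn //.
  rewrite ler_ln ?posrE ?exprn_gt0 //.
  by rewrite -natrX ler_nat trunc_logP // (leq_trans _ C_ge2).
have log_gt0 : 0 < log2 C%:R :> R by rewrite (lt_le_trans l_gt0).
move: (log2 _) l_le log_gt0 => x l_le x_gt0.
rewrite div1r !natrM ltf_pV2 ?posrE ?mulr_gt0 //.
apply: (@lt_le_trans _ _ (64 * C%:R * l%:R)); first by rewrite !ltr_pM2r // ltr_nat.
by rewrite ler_wpM2l // mulr_ge0 // ltW.
Qed.

Theorem theorem9 (R : realType) (C : nat) (T : set nat)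
    (C_ge2 : (2 <= C)%N)
    (T_pos : forall t, T t -> (0 < t)%N)
    (T_sparse : forall j : int, T `&` dyadic_interval R j #<= `I_C) :
  let eps : R := 1 / (64 * C%:R * log2 C%:R) in
  (exists theta : R, forall t, T t -> eps_regular eps t theta) /\
  (computable_set T ->
   exists theta : R,
     computable_real theta /\ forall t, T t -> eps_regular eps t theta).
Proof.
move=> eps; pose Tb t := `[< T t >].
pose l := trunc_log 2 C; pose E := (63 * C * l)%N; pose h := (8 * l).-1.
have C_gt0 : (0 < C)%N by apply: leq_trans C_ge2.
have l_gt0 : (0 < l)%N by rewrite trunc_log_gt0.
have Eh_sustainable : sustainable R E h C.
  by apply: sustainable_log => //; apply: trunc_log_ltn.
have Tb_bounded : octave_bounded C h Tb.
  by have := octave_bounded_sparse h T_sparse.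
have [theta theta_digits] : exists x : R, dyadic_limit (2 ^+ h) (digits R Tb E h) x.
  exact: dyadic_limit_exists (exprn_ge0 h (ler0n R 2)) (digits_step R Tb E h).
have regular t : T t -> eps_regular eps t theta.
  move=> Tt; apply: lt_le_trans (eps_lt_trunc_log R C_ge2) _.
  exact: digits_regular Eh_sustainable Tb_bounded theta_digits (asboolT Tt) (T_pos _ Tt).
split=> [|T_comp]; exists theta => //; split=> //.
apply: (computable_dyadic_limit _ theta_digits).
by apply: (@computable_digits R T) => //; case: Eh_sustainable; lia.
Qed.
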